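(* Let $G$ be a finite connected bigraph, let $C$ be a set of colors, let $\mathcal{F}\subseteq\mathrm{Fold}(G)$ be a set of folds of $G$ that is $\mathrm{Aut}(G)$-invariant, let $\mathcal{M}\subseteq C^{E(G)}$ be the set of monochromatic colorings $E(G)\to C$, and let $r\colon E(G)\to C$ be a rainbow coloring of $G$. Then the following are equivalent: (1) $G$ is $\mathcal{F}$-cut-percolating. (2) $c\preceq_{\mathcal{F}}\mathcal{M}$ for every coloring $c\colon E(G)\to C$. (3) $r\preceq_{\mathcal{F}}\mathcal{M}$. (4) $c\ll_{\mathcal{F}}\mathcal{M}$ for every coloring $c\colon E(G)\to C$. (5) $r\ll_{\mathcal{F}}\mathcal{M}$. (6) Every $(\mathrm{Aut}(G),\mathcal{F})$-fold-stable coloring $c\colon E(G)\to C$ is monochromatic. (7) Every $\mathrm{Fold}(G)$-strongly $(\mathrm{Aut}(G),\mathcal{F})$-fold-stable coloring $c\colon E(G)\to C$ is monochromatic. (8) Every $\preceq_{\mathcal{F}}$-maximal coloring $c\colon E(G)\to C$ is monochromatic. (9) Every $\mathrm{Fold}(G)$-symmetrically $(\mathrm{Aut}(G),\mathcal{F})$-fold-stable coloring $c\colon E(G)\to C$ is monochromatic, and $G$ is $K$-edge-transitive, where $K$ is the subgroup of $\mathrm{Aut}(G)$ generated by $\{f\mid (f,L)\in\mathcal{F}\}$.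
   Context: A bigraph is a triple $G=(V_1(G),V_2(G),E(G))$ with $V_1(G),V_2(G)$ disjoint sets and $E(G)\subseteq V_1(G)\times V_2(G)$; $V(G)=V_1(G)\cup V_2(G)$; $G$ is finite if $V(G)$ is finite. An automorphism of $G$ is a bijection $h$ of $V(G)$ with $h(V_i(G))=V_i(G)$ and $(u,v)\in E(G)\iff (h(u),h(v))\in E(G)$; $\mathrm{Aut}(G)$ is their group. Maps $V(G)\to V(G)$ act on pairs coordinatewise. Connectivity refers to the underlying undirected graph; for $S\subseteq V(G)$, $G-S$ is the induced bigraph on $V(G)\setminus S$, and $S$ is a cut if $G-S$ is disconnected. A cut-involution of $G$ is $f\in\mathrm{Aut}(G)$ with $f\circ f=\mathrm{id}$ and $\mathrm{Fix}(f)=\{v: f(v)=v\}$ a cut. A fold of $G$ is a pair $(f,L)$ with $f$ a cut-involution, $L$ a union of connected components of $G-\mathrm{Fix}(f)$, and $(L,\mathrm{Fix}(f),f(L))$ a partition of $V(G)$; $\mathrm{Fold}(G)$ is the set of folds. The dual fold of $(f,L)$ is $(f,f(L))$. The folding maps $f_L,f_L^*\colon V(G)\to V(G)$ are: $f_L(v)=f(v)$ for $v\in\mathrm{Fix}(f)\cup f(L)$ and $f_L(v)=v$ for $v\in L$; $f_L^*(v)=f(v)$ for $v\in L$ and $f_L^*(v)=v$ otherwise. A set $\mathcal{F}$ of folds is $K$-invariant ($K\le\mathrm{Aut}(G)$) if $(h\circ f\circ h^{-1},h(L))\in\mathcal{F}$ for all $h\in K$, $(f,L)\in\mathcal{F}$.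 A coloring is a map $c\colon E(G)\to C$; it is monochromatic if $|\mathrm{im}(c)|\le 1$, rainbow if injective. For a map $\varphi\colon V(G)\to V(G)$ sending edges to edges, $c\circ\varphi$ is the coloring $(u,v)\mapsto c(\varphi(u),\varphi(v))$. An isomorphism from $(G,c)$ to $(G,c')$ is $g\in\mathrm{Aut}(G)$ with $c'\circ g=c$; $\mathrm{Aut}((G,c))$ is the group of $g\in\mathrm{Aut}(G)$ with $c\circ g=c$. $G$ is $K$-edge-transitive if for all $e_1,e_2\in E(G)$ there is $h\in K$ with $h(e_1)=e_2$. Reachability: $c\preceq_{\mathcal{F}}c'$ if there are $t\ge 0$ and folds $(f_1,L_1),\dots,(f_t,L_t)$, each of which or whose dual lies in $\mathcal{F}$, with $c'=c\circ(f_1)_{L_1}\circ\cdots\circ(f_t)_{L_t}$. For a set $\mathcal{C}$ of colorings, $c\preceq_{\mathcal{F}}\mathcal{C}$ means $c\preceq_{\mathcal{F}}c'$ for some $c'\in\mathcal{C}$. $c$ is $\preceq_{\mathcal{F}}$-maximal if $c\preceq_{\mathcal{F}}c'$ implies $c'\preceq_{\mathcal{F}}c$. Percolation: a binary tree is a prefix-closed set $T$ of finite strings over $\{1,2\}$; $|\eta|$ is the length; leaves $L(T)$ are the prefix-maximal elements; $T\!\uparrow=\{\emptyset\}\cup\{\eta\neq\emptyset:\ \eta\text{ with its last symbol removed lies in }T\}$. A folding tree is a map $\phi\colon T\to\mathrm{Fold}(G)$; for a coloring $c$, $\phi[c]\colon T\!\uparrow\to C^{E(G)}$ is defined by $\phi[c](\emptyset)=c$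 and, for $\eta=\eta'i$ with $\phi(\eta')=(f,L)$, $\phi[c](\eta)=\phi[c](\eta')\circ f_L$ if $i=1$ and $\phi[c](\eta')\circ f_L^*$ if $i=2$. For finite $T$, $\mu_{\phi[c]}(\mathcal{C})=\sum_{\eta\in L(T\uparrow),\,\phi[c](\eta)\in\mathcal{C}}2^{-|\eta|}$. We write $c\ll_{\mathcal{F}}\mathcal{C}$ if there are finite binary trees $T_0\subseteq T_1\subseteq\cdots$ and folding trees $\phi_n\colon T_n\to\mathcal{F}$ with $\phi_{n+1}|_{T_n}=\phi_n$ and $\lim_n\mu_{\phi_n[c]}(\mathcal{C})=1$. $G$ is $\mathcal{F}$-cut-percolating if there are $E_0,\dots,E_n\subseteq E(G)$ with $|E_0|=1$, $E_n=E(G)$, and for each $i\in[n]$ a fold $(f,L)\in\mathcal{F}$ with $E_i=f_L^{-1}(E_{i-1})$. Fold-stability, for $K\le\mathrm{Aut}(G)$ and $\mathcal{F},\mathcal{F}'\subseteq\mathrm{Fold}(G)$: $c$ is $(K,\mathcal{F})$-fold-stable if for every $(f,L)\in\mathcal{F}$ some $g\in K$ is an isomorphism from $(G,c)$ to $(G,c\circ f_L)$; $\mathcal{F}'$-strongly $(K,\mathcal{F})$-fold-stable if moreover for every $(f,L)\in\mathcal{F}$ there is $h\in\mathrm{Aut}((G,c))$ with $\mathrm{Fix}(h)=\mathrm{Fix}(f)$ and $(h,L)\in\mathcal{F}'$; $\mathcal{F}'$-symmetrically $(K,\mathcal{F})$-fold-stable if it is $\mathcal{F}'$-strongly $(K,\mathcal{F})$-fold-stable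 and for all $i,j\in\mathrm{im}(c)$ there are $g\in K$ and a permutation $\sigma$ of $C$ with $\sigma(i)=j$ and $g$ an isomorphism from $(G,c)$ to $(G,\sigma\circ c)$.
   Formalization: The formal theorem additionally assumes that E(G) is nonempty; for an edgeless connected bigraph (a single vertex) item (1) fails because |E_0|=1 is impossible, while item (2) holds, so the equivalence as stated is false there. *)

(* Defs.v *)
From mathcomp Require Import all_boot all_algebra all_fingroup finmap.
From mathcomp Require Import boolp classical_sets reals.
From mathcomp Require Import topology normedtype sequences.

Set Implicit Arguments.
Unset Strict Implicit.
Unset Printing Implicit Defensive.

Import GRing.Theory numFieldNormedType.Exports.

Record bigraph := Bigraph {
  vertex :> finType;
  part1 : {set vertex};
  part2 : {set vertex};
  edges : {set vertex * vertex};
  part_disjoint : [disjoint part1 & part2];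
  part_cover : part1 :|: part2 = [set: vertex];
  edges_parts : edges \subset finset.setX part1 part2 }.

Definition edge (G : bigraph) := {e : G * G | e \in edges G}.

Section Bigraph.
Variable G : bigraph.

(* A set of folds is such a family contained in Fold, defined below. *)
Local Notation fold_family := {set {perm G} * {set G}}.

Definition pair_map (phi : G -> G) (e : G * G) : G * G := (phi e.1, phi e.2).

Definition preserves_edges (phi : G -> G) :=
  forall e, e \in edges G -> pair_map phi e \in edges G.

Definition edge_map phi (phiE : preserves_edges phi) (e : edge G) : edge G :=
  exist _ (pair_map phi (val e)) (phiE (val e) (valP e)).

Definition graph_aut : {set {perm G}} :=
  [set h : {perm G} | [&& h @: part1 G == part1 G, h @: part2 G == part2 G &
     [forall u, forall v, ((u, v) \in edges G) == ((h u, h v) \in edges G)]]].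

Lemma graph_autP (h : {perm G}) :
  reflect [/\ h @: part1 G = part1 G, h @: part2 G = part2 G &
             forall u v, ((u, v) \in edges G) = ((h u, h v) \in edges G)]
          (h \in graph_aut).
Proof.
rewrite inE; apply: (iffP and3P) => [[/eqP h1 /eqP h2 /forallP h3] | [h1 h2 h3]].
  by split=> // u v; apply/eqP; move/forallP: (h3 u).
by split; [apply/eqP | apply/eqP | apply/forallP=> u; apply/forallP=> v; rewrite h3].
Qed.

Lemma graph_aut_group_set : group_set graph_aut.
Proof.
apply/group_setP; split=> [|g h /graph_autP[g1 g2 g3] /graph_autP[h1 h2 h3]].
  apply/graph_autP; split=> [||u v]; last by rewrite !perm1.
    by under eq_imset do rewrite perm1; exact: imset_id.
  by under eq_imset do rewrite perm1; exact: imset_id.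
apply/graph_autP; split=> [||u v]; last by rewrite !permM -h3 -g3.
  by under eq_imset do rewrite permM; rewrite (imset_comp h g) g1 h1.
by under eq_imset do rewrite permM; rewrite (imset_comp h g) g2 h2.
Qed.

Canonical graph_aut_group := Group graph_aut_group_set.

Lemma graph_aut_edges h : h \in graph_aut -> preserves_edges h.
Proof. by move=> /graph_autP[_ _ hE] [u v]; rewrite hE. Qed.

(* Adjacency of the undirected graph underlying G - S. *)
Definition adj_off (S : {set G}) : rel G := fun u v =>
  [&& u \notin S, v \notin S & ((u, v) \in edges G) || ((v, u) \in edges G)].

Definition connected_off (S : {set G}) :=
  [forall u in ~: S, forall v in ~: S, connect (adj_off S) u v].

Definition connected_bigraph := connected_off finset.set0.

Definition components_off (S : {set G}) : {set {set G}} :=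
  equivalence_partition (connect (adj_off S)) (~: S).

Definition is_cut (S : {set G}) := ~~ connected_off S.

Definition fixed_points (f : {perm G}) : {set G} := [set v | f v == v].

Definition cut_involution (f : {perm G}) :=
  [&& f \in graph_aut, [forall v, f (f v) == v] & is_cut (fixed_points f)].

Definition is_fold (x : {perm G} * {set G}) :=
  let: (f, L) := x in
  [/\ cut_involution f,
      exists2 P : {set {set G}}, P \subset components_off (fixed_points f) & L = finset.cover P
    & [/\ [disjoint L & fixed_points f], [disjoint L & f @: L],
          [disjoint fixed_points f & f @: L] & L :|: fixed_points f :|: f @: L = [set: G]]].

Definition Fold : fold_family := [set x | `[< is_fold x >]].

Definition fold := {x : {perm G} * {set G} | x \in Fold}.

Definition dual (x : {perm G} * {set G}) := (x.1, x.1 @: x.2).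

Definition fold_map (x : {perm G} * {set G}) (v : G) : G :=
  let: (f, L) := x in if v \in fixed_points f :|: f @: L then f v else v.

Definition fold_map_star (x : {perm G} * {set G}) (v : G) : G :=
  let: (f, L) := x in if v \in L then f v else v.

Lemma cover_components_adj S (P : {set {set G}}) u v :
  P \subset components_off S -> adj_off S u v ->
  (u \in finset.cover P) = (v \in finset.cover P).
Proof.
have adjC x y : adj_off S x y = adj_off S y x.
  by rewrite /adj_off andbCA [X in _ && (_ && X)]orbC.
have impl x y : P \subset components_off S -> adj_off S x y ->
    x \in finset.cover P -> y \in finset.cover P.
  move=> sP xy /finset.bigcupP[B PB Bx]; apply/finset.bigcupP; exists B => //.
  have /imsetP[z _ defB] := fintype.subsetP sP _ PB.
  move: Bx; rewrite defB !inE => /andP[_ zx].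
  by case/and3P: (xy) => _ -> _; rewrite (connect_trans zx (connect1 xy)).
by move=> sP uv; apply/idP/idP; apply: impl => //; rewrite adjC.
Qed.

Lemma fold_edge_cases (x : fold) u v : (u, v) \in edges G ->
  let: (f, L) := val x in
  [\/ [/\ u \in fixed_points f :|: f @: L, u \notin L, v \in fixed_points f :|: f @: L & v \notin L],
      [/\ u \in L, u \notin fixed_points f :|: f @: L & v \in L /\ v \notin fixed_points f :|: f @: L],
      f u = u | f v = v].
Proof.
case: x => -[f L] /= xP; move: (xP); rewrite inE => /asboolP.
case=> _ [P sP defL] [dLF dLf dFf covL] uv.
have [fu|fu] := eqVneq (f u) u; first by constructor 3.
have [fv|fv] := eqVneq (f v) v; first by constructor 4.
have uvL : (u \in L) = (v \in L).
  by rewrite defL; apply: (cover_components_adj sP); rewrite /adj_off !inE fu fv uv.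
have inLF w : f w != w -> (w \in fixed_points f :|: f @: L) = (w \notin L).
  move=> fw; rewrite !inE (negPf fw) /=; apply/idP/idP => [wfL|wL].
    by apply/negP=> wL; rewrite (disjointFr dLf wL) in wfL.
  by have := finset.in_setT w; rewrite -covL !inE (negPf fw) (negPf wL).
rewrite !inLF //; have [uL|uL] := boolP (u \in L); rewrite -uvL uL.
  by constructor 2.
by constructor 1.
Qed.

Lemma fold_aut (x : fold) : (val x).1 \in graph_aut.
Proof. by case: x => -[f L] /=; rewrite inE => /asboolP[/and3P[]]. Qed.

Lemma fold_map_edges (x : fold) : preserves_edges (fold_map (val x)).
Proof.
move=> [u v] uv; have := fold_edge_cases x uv; have := graph_aut_edges (fold_aut x) uv.
have /graph_autP[_ _ fE] := fold_aut x.
case: x fE => -[f L] xP /= fE fuv; rewrite /pair_map /=.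
case=> [[-> _ -> _]|[_ /negPf-> [_ /negPf->]]|fu|fv] //.
- by rewrite fu if_same; case: ifP => // _; rewrite -{1}fu.
- by rewrite fv if_same; case: ifP => // _; rewrite -{1}fv.
Qed.

Lemma fold_map_star_edges (x : fold) : preserves_edges (fold_map_star (val x)).
Proof.
move=> [u v] uv; have := fold_edge_cases x uv; have := graph_aut_edges (fold_aut x) uv.
case: x => -[f L] xP /= fuv; rewrite /pair_map /=.
case=> [[_ /negPf-> _ /negPf->]|[-> _ [-> _]]|fu|fv] //.
- by rewrite fu if_same; case: ifP => // _; rewrite -{1}fu.
- by rewrite fv if_same; case: ifP => // _; rewrite -{1}fv.
Qed.

Definition fold_edge (x : fold) : edge G -> edge G := edge_map (@fold_map_edges x).

Definition fold_edge_star (x : fold) : edge G -> edge G :=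
  edge_map (@fold_map_star_edges x).

(* In {perm G}, f ^ h = h^-1 * f * h applies h^-1 first: it is the map
   h \o f \o h^-1. *)
Definition invariant_folds (K : {group {perm G}})
    (F : fold_family) :=
  forall h f L, h \in K -> (f, L) \in F -> ((f ^ h)%g, h @: L) \in F.

(* The preimages are taken under f_L as a self-map of E(G). *)
Definition cut_percolating (F : fold_family) :=
  exists (n : nat) (E : nat -> {set edge G}),
    [/\ #|E 0%N| = 1%N, E n = [set: edge G] &
        forall i, (i < n)%N ->
          exists2 x : fold, val x \in F & E i.+1 = fold_edge x @^-1: E i].

Definition edge_transitive (K : {group {perm G}}) :=
  forall e1 e2 : edge G, exists2 h, h \in K & pair_map h (val e1) = val e2.

Definition fold_group (F : fold_family) : {group {perm G}} :=
  <<[set x.1 | x in F]>>%G.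

Section Colorings.
Variable C : Type.

Definition coloring := edge G -> C.

Definition monochromatic (c : coloring) := is_subset1 (range c).

Definition rainbow (c : coloring) := injective c.

Definition color_iso (g : {perm G}) (c c' : coloring) :=
  exists gA : g \in graph_aut, c' \o edge_map (graph_aut_edges gA) = c.

Definition reach (F : fold_family) (c c' : coloring) :=
  exists2 s : seq fold,
    forall x, x \in s -> val x \in F \/ dual (val x) \in F &
    c' = foldl (fun d x => d \o fold_edge x) c s.

Definition reach_set F (c : coloring) (A : set coloring) :=
  exists2 c', A c' & reach F c c'.

Definition reach_maximal F (c : coloring) :=
  forall c', reach F c c' -> reach F c' c.

Definition fold_stable (K : {group {perm G}}) (F : fold_family)
    (c : coloring) :=
  forall x : fold, val x \in F ->
    exists2 g, g \in K & color_iso g c (c \o fold_edge x).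

Definition strongly_fold_stable (F' : fold_family)
    (K : {group {perm G}}) (F : fold_family) (c : coloring) :=
  fold_stable K F c /\
  forall f L, (f, L) \in F ->
    exists h, [/\ color_iso h c c, fixed_points h = fixed_points f & (h, L) \in F'].

Definition symmetrically_fold_stable (F' : fold_family)
    (K : {group {perm G}}) (F : fold_family) (c : coloring) :=
  strongly_fold_stable F' K F c /\
  forall i j, range c i -> range c j ->
    exists (g : {perm G}) (sigma : C -> C),
      [/\ g \in K, bijective sigma, sigma i = j & color_iso g c (sigma \o c)].

End Colorings.

(* A finite string over {1, 2} is a list of booleans with its LAST symbol
   first, the symbol 1 being false and 2 being true: appending i to eta is
   i :: eta, and the initial segments of a string are the suffixes of the list. *)
Definition binary_tree (T : {fset seq bool}) :=
  forall s t, suffix s t -> t \in T -> s \in T.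

Definition tree_up (T : {fset seq bool}) : {fset seq bool} :=
  ([fset [::]] `|` [fset i :: eta | i in [fset false; true], eta in T])%fset.

Definition leaves (T : {fset seq bool}) : {fset seq bool} :=
  [fset eta in T | all (fun t => suffix eta t ==> (t == eta)) T]%fset.

(* A folding tree T -> F is a finite map with domain T. *)
Definition folding_tree (F : fold_family)
    (phi : {fmap seq bool -> fold}) :=
  binary_tree (domf phi) /\
  forall eta x, phi.[? eta]%fmap = Some x -> val x \in F.

Section TreeColorings.
Variable C : Type.

(* phi[c]; only its values on tree_up (domf phi) are meaningful, and there
   the None branch is not reached. *)
Fixpoint tree_coloring (phi : {fmap seq bool -> fold}) (c : coloring C)
    (eta : seq bool) : coloring C :=
  if eta is i :: eta' then
    let d := tree_coloring phi c eta' in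
    if phi.[? eta']%fmap is Some x
    then d \o (if i then fold_edge_star x else fold_edge x) else d
  else c.

Definition tree_measure (R : realType) (phi : {fmap seq bool -> fold})
    (c : coloring C) (A : set (coloring C)) : R :=
  (\sum_(eta <- leaves (tree_up (domf phi)) | `[< A (tree_coloring phi c eta) >])
     2%:R ^- size eta)%R.

Definition percolates (R : realType) (F : fold_family)
    (c : coloring C) (A : set (coloring C)) :=
  exists phi : nat -> {fmap seq bool -> fold},
    [/\ forall n, folding_tree F (phi n),
        forall n, (domf (phi n) `<=` domf (phi n.+1))%fset /\
                  (phi n.+1).[& domf (phi n)]%fmap = phi n &
        (tree_measure R (phi n) c A @[n --> \oo] --> (1%R : R))%classic].

End TreeColorings.

End Bigraph.

(* Main.v *)
Require Import Defs.
From mathcomp Require Import all_boot all_fingroup.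
From mathcomp Require Import classical_sets reals.
From mathcomp Require Import all_order all_algebra finmap zify boolp.
From mathcomp Require Import topology normedtype sequences.

(* Let M be the monoid of self-maps of E(G) generated by the folding maps of F;
   it contains the dual folding maps, since F is invariant under the fold
   involutions.  Conditions (1)-(3) all say that M contains a constant map, and
   so do (4) and (5): repeating periodically a word whose composite is
   constant, a random branch avoids that word k times with probability at most
   (1 - 2^-n)^k, where n is the length of the word.

   The colorings reachable from a fold-stable coloring are isomorphic to it, so
   if M contains a constant map then every fold-stable coloring is
   monochromatic.  Conversely, a maximal coloring c is strongly fold-stable.
   Indeed, for the number hom(d) of color-preserving maps from (G, d) to a fixed
   subset of (G, c), splitting along Fix(f) and AM-GM give
   2 hom(d) <= hom(d \o f_L) + hom(d \o f_L'), where f_L' is the dual folding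
   map, so hom is constant on the colorings reachable from c and equality holds.
   Equality means that the two sides of the fold, rooted at Fix(f), have the
   same homomorphism counts, and counting the maps with prescribed image yields
   (as in Lovasz's theorem) an automorphism p of G supported in L that turns one
   side into the other; then f conjugated by p is a fold preserving c.

   Finally, if G is edge-transitive under the folds, the maximal colorings
   reachable from the rainbow coloring are even symmetrically fold-stable. *)

Set Implicit Arguments.
Unset Strict Implicit.
Unset Printing Implicit Defensive.

Import Order.TTheory GRing.Theory Num.Theory numFieldNormedType.Exports.

(** * Folds and their edge maps *)

Section Folds.
Variable G : bigraph.
Implicit Types (x y : fold G) (g h : {perm G}) (u v : G).

Definition aut_edge g (gA : g \in graph_aut G) : edge G -> edge G :=
  edge_map (graph_aut_edges gA).

Lemma foldP x : is_fold (val x).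
Proof. by case: x => z zF /=; move: (zF); rewrite inE => /asboolP. Qed.

Lemma fold_invol x v : (val x).1 ((val x).1 v) = v.
Proof.
have := foldP x; case: (val x) => f L /= [/and3P[_ /forallP ff _] _ _].
exact/eqP/ff.
Qed.

Lemma fold_side_disjoint x v : v \in (val x).2 -> (val x).1 v \notin (val x).2.
Proof.
have := foldP x; case: (val x) => f L /= [_ _ [_ dL _ _]] vL.
by rewrite (disjointFl dL) // imset_f.
Qed.

Lemma fold_cover x v :
  [\/ (val x).1 v = v, v \in (val x).2 | (val x).1 v \in (val x).2].
Proof.
have := fold_invol x; have := foldP x.
case: (val x) => f L /= [_ _ [_ _ _ cov]] ff.
have := finset.in_setT v; rewrite -cov !inE => /orP[/orP[vL|/eqP fv]|/imsetP[w wL ->]].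
- by constructor 2.
- by constructor 1.
- by constructor 3; rewrite ff.
Qed.

Lemma fold_fixed_notin x v : (val x).1 v = v -> v \notin (val x).2.
Proof. by move=> fv; apply/negP=> vL; have := fold_side_disjoint vL; rewrite fv vL. Qed.

(** No edge joins L to f(L): an edge without fixed ends stays in one component of G - Fix(f), and a
    fixed vertex lies on neither side. *)
Lemma fold_edge_side x u v : (u, v) \in edges G ->
  (u \in (val x).2 -> (val x).1 v \notin (val x).2) /\
  (v \in (val x).2 -> (val x).1 u \notin (val x).2).
Proof.
move=> uv; have := fold_edge_cases x uv.
have := @fold_fixed_notin x; have := @fold_side_disjoint x; have := fold_invol x.
case: (val x) => f L /= ff dL fx.
have inF w : (w \in fixed_points f :|: f @: L) = false -> f w \notin L.
  move=> /negbT; rewrite !inE negb_or => /andP[_]; apply: contra => fwL.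
  by rewrite -(ff w) imset_f.
case=> [[_ /negPf-> _ /negPf->]|[_ /negPf/inF-> [_ /negPf/inF->]]|fu|fv] //.
  by rewrite fu (negPf (fx _ fu)).
by rewrite fv (negPf (fx _ fv)).
Qed.

(** Since f is an involution, v lies in f(L) exactly when f v lies in L; on Fix(f) both branches
    return v. *)
Lemma fold_mapE x v :
  fold_map (val x) v = if (val x).1 v \in (val x).2 then (val x).1 v else v.
Proof.
have := fold_invol x; have := foldP x; case: (val x) => f L /= [_ _ _] ff.
have -> : (f v \in L) = (v \in f @: L).
  apply/idP/imsetP=> [fvL|[w wL ->]]; last by rewrite ff.
  by exists (f v).
rewrite !inE; case: eqP => [->|_] //=; by case: ifP.
Qed.

Lemma fold_map_starE x v :
  fold_map_star (val x) v = if v \in (val x).2 then (val x).1 v else v.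
Proof. by case: (val x). Qed.

Lemma fold_map_fixed x v : (val x).1 v = v -> fold_map (val x) v = v.
Proof. by move=> fv; rewrite fold_mapE fv if_same. Qed.

Lemma fold_map_star_fixed x v : (val x).1 v = v -> fold_map_star (val x) v = v.
Proof. by move=> fv; rewrite fold_map_starE fv if_same. Qed.

Lemma fold_map_invol x v : fold_map (val x) ((val x).1 v) = fold_map (val x) v.
Proof.
rewrite !fold_mapE fold_invol; have := @fold_side_disjoint x v.
case: (fold_cover x v) => [->|vL|fvL]; first by rewrite !if_same.
  by rewrite vL => /(_ isT)/negPf->.
move=> _; have := fold_side_disjoint fvL; rewrite fold_invol => /negPf->.
by rewrite fvL.
Qed.

Lemma fold_map_star_invol x v :
  fold_map_star (val x) ((val x).1 v) = fold_map_star (val x) v.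
Proof.
rewrite !fold_map_starE fold_invol; have := @fold_side_disjoint x v.
case: (fold_cover x v) => [->|vL|fvL]; first by rewrite !if_same.
  by rewrite vL => /(_ isT)/negPf->.
move=> _; have := fold_side_disjoint fvL; rewrite fold_invol => /negPf->.
by rewrite fvL.
Qed.

Lemma fold_mapK x v : fold_map (val x) (fold_map (val x) v) = fold_map (val x) v.
Proof. by rewrite [in LHS](fold_mapE x v); case: ifP => // _; rewrite fold_map_invol. Qed.

Lemma fold_map_star_id x v :
  fold_map (val x) (fold_map_star (val x) v) = fold_map (val x) v.
Proof. by rewrite fold_map_starE; case: ifP => // _; rewrite fold_map_invol. Qed.

Lemma fold_star_map_id x v :
  fold_map_star (val x) (fold_map (val x) v) = fold_map_star (val x) v.
Proof. by rewrite fold_mapE; case: ifP => // _; rewrite fold_map_star_invol. Qed.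

Lemma fold_map_star_starK x v :
  fold_map_star (val x) (fold_map_star (val x) v) = fold_map_star (val x) v.
Proof. by rewrite [in LHS](fold_map_starE x v); case: ifP => // _; rewrite fold_map_star_invol. Qed.

Lemma graph_aut_part1 h v : h \in graph_aut G -> (h v \in part1 G) = (v \in part1 G).
Proof. by case/graph_autP=> {1}<- _ _; rewrite mem_imset //; exact: perm_inj. Qed.

Lemma part2E v : (v \in part2 G) = (v \notin part1 G).
Proof.
have := finset.in_setT v; rewrite -part_cover inE.
have [v1 _|_ /= ->] := boolP (v \in part1 G) => //.
by rewrite (disjointFr (part_disjoint G)).
Qed.

(** The map induced on the finite set E(G) is injective, hence onto, so a permutation that preserves
    edges also reflects them. *)
Lemma graph_aut_of_edges h : (forall v, (h v \in part1 G) = (v \in part1 G)) ->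
  preserves_edges h -> h \in graph_aut G.
Proof.
move=> h1 hE.
have imh (A : {set G}) : (forall v, (h v \in A) = (v \in A)) -> h @: A = A.
  move=> hA; apply/eqP; rewrite eqEcard (card_imset _ (@perm_inj _ h)) leqnn andbT.
  by apply/fintype.subsetP=> _ /imsetP[v vA ->]; rewrite hA.
apply/graph_autP; split; [exact: imh|by apply: imh => v; rewrite !part2E h1|].
have pinj : injective (pair_map h).
  by move=> [a b] [a' b'] [/perm_inj-> /perm_inj->].
have imE : pair_map h @: edges G = edges G.
  apply/eqP; rewrite eqEcard (card_imset _ pinj) leqnn andbT.
  by apply/fintype.subsetP=> _ /imsetP[e eE ->]; exact: hE.
by move=> u v; rewrite -{2}imE (mem_imset _ (u, v) pinj).
Qed.

Lemma aut_edgeM g h (gA : g \in graph_aut G) (hA : h \in graph_aut G) e :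
  aut_edge (groupM gA hA : (g * h)%g \in graph_aut G) e = aut_edge hA (aut_edge gA e).
Proof. by apply: val_inj; rewrite /= /pair_map /= !permM. Qed.

Lemma aut_edgeKV g (gA : g \in graph_aut G) (gA' : g^-1%g \in graph_aut G) e :
  aut_edge gA (aut_edge gA' e) = e.
Proof. by apply: val_inj; case: e => -[u v] uv; rewrite /= /pair_map /= !permKV. Qed.

(** No edge crosses the fold, so the two ends are both moved by f or both kept; a fixed end fits
    either case. *)
Lemma fold_map_edge_aut x (e : edge G) :
  pair_map (fold_map (val x)) (val e) = val e \/
  pair_map (fold_map (val x)) (val e) = pair_map (val x).1 (val e).
Proof.
case: e => -[u v] uv; rewrite /pair_map /= !fold_mapE.
have [h1 h2] := @fold_edge_side x u v uv.
case: ifP => fu; case: ifP => fv; [by right| |  |by left].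
  right; case: (fold_cover x v) => [-> //|/h2|]; by rewrite ?fu ?fv.
right; case: (fold_cover x u) => [-> //|/h1|]; by rewrite ?fu ?fv.
Qed.

Lemma color_isoP (C : Type) g (c c' : coloring G C) :
  color_iso g c c' <-> exists gA : g \in graph_aut G, forall e, c' (aut_edge gA e) = c e.
Proof.
split=> -[gA gc]; exists gA; first by move=> e; rewrite -gc.
by apply/funext=> e; exact: gc.
Qed.

End Folds.

(** * The monoid generated by the folding maps *)

Section Monoid.
Variables (G : bigraph) (F : {set {perm G} * {set G}}).
Hypothesis F_folds : F \subset Fold G.
Hypothesis F_invariant : invariant_folds (graph_aut_group G) F.
Implicit Types (x y : fold G) (p q : edge G -> edge G).

(* Since c \o f_1 \o ... \o f_t applies the last fold first, the colorings
   reachable from c are the c \o p for p in this monoid. *)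
Inductive fold_monoid : (edge G -> edge G) -> Prop :=
| FoldMonoid1 : fold_monoid id
| FoldMonoidS p x : fold_monoid p -> val x \in F -> fold_monoid (p \o fold_edge x).

Lemma fold_monoid_comp p q : fold_monoid p -> fold_monoid q -> fold_monoid (p \o q).
Proof. by move=> pM; elim=> {q} // q x _ IH xF; exact: (FoldMonoidS IH xF). Qed.

Definition fold_of z (zF : z \in F) : fold G :=
  exist (fun z => z \in Fold G) z (fintype.subsetP F_folds z zF).

(** Conjugating (f, L) by f itself gives (f, f(L)). *)
Lemma dual_in (z : {perm G} * {set G}) : z \in F -> dual z \in F.
Proof.
case: z => f L zF; have := F_invariant (fold_aut (fold_of zF)) zF.
by rewrite conjgE mulgA mulVg mul1g.
Qed.

Lemma dual_dual x : dual (dual (val x)) = val x.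
Proof.
rewrite /dual /=; have ff := fold_invol x; case: x ff => -[f L] /= _ ff.
by congr pair; rewrite -imset_comp -[RHS]imset_id; apply: eq_imset.
Qed.

Lemma fold_map_dual x v : fold_map (dual (val x)) v = fold_map_star (val x) v.
Proof.
rewrite fold_map_starE /dual /= -imset_comp.
have -> : [set ((val x).1 \o (val x).1) w | w in (val x).2] = (val x).2.
  by rewrite -[RHS]imset_id; apply: eq_imset => w /=; rewrite fold_invol.
by rewrite !inE; case: eqP => [->|_] //=; rewrite if_same.
Qed.

Lemma fold_edge_starE x : val x \in F ->
  exists2 y, val y \in F & fold_edge y = fold_edge_star x.
Proof.
move=> xF; have dF := dual_in xF.
exists (fold_of dF) => //.
by apply/funext=> e; apply: val_inj; rewrite /= /pair_map !fold_map_dual.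
Qed.

Lemma reachP (C : Type) (c c' : coloring G C) :
  reach F c c' <-> exists2 p, fold_monoid p & c' = c \o p.
Proof.
split=> [[s sF ->]|[p pM ->]].
  elim/last_ind: s sF => [|s x IH] sF; first by exists id; [constructor|].
  have [|p pM E] := IH; first by move=> y ys; apply: sF; rewrite mem_rcons inE ys orbT.
  rewrite foldl_rcons E; exists (p \o fold_edge x) => //.
  have xF : val x \in F.
    case: (sF x) => [|//|/dual_in]; first by rewrite mem_rcons mem_head.
    by rewrite dual_dual.
  exact: FoldMonoidS.
elim: pM => {p} [|p x _ [s sF E] xF]; first by exists [::].
exists (rcons s x); last by rewrite foldl_rcons -E.
by move=> y; rewrite mem_rcons inE => /predU1P[->|/sF//]; left.
Qed.

Lemma fold_conj x g (gA : g \in graph_aut G) : val x \in F -> exists2 y, val y \in F &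
  forall e, aut_edge gA (fold_edge x e) = fold_edge y (aut_edge gA e).
Proof.
move=> xF; have yF : (((val x).1 ^ g)%g, g @: (val x).2) \in F.
  by apply: F_invariant => //; case: (val x) xF.
exists (fold_of yF) => // e; apply: val_inj.
have gmap v : g (fold_map (val x) v) = fold_map (((val x).1 ^ g)%g, g @: (val x).2) (g v).
  rewrite fold_mapE [RHS](fold_mapE (fold_of yF)) /= permJ.
  by rewrite mem_imset; [case: ifP|exact: perm_inj].
by rewrite /= /pair_map /= !gmap.
Qed.

Lemma fold_monoid_conj p g (gA : g \in graph_aut G) : fold_monoid p ->
  exists2 q, fold_monoid q & forall e, aut_edge gA (p e) = q (aut_edge gA e).
Proof.
elim=> {p} [|p x _ [q qM pq] xF]; first by exists id; [constructor|].
have [y yF xy] := fold_conj gA xF; exists (q \o fold_edge y); first exact: FoldMonoidS.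
by move=> e /=; rewrite pq xy.
Qed.

(** If c \o p = c \o g with g an automorphism, a further folding map moves past g and becomes that
    of a conjugate fold in F. Stability under the conjugate fold replaces it by an automorphism
    [h^-1]. *)
Lemma fold_stable_reach (C : Type) (c : coloring G C) p :
  fold_stable (graph_aut_group G) F c -> fold_monoid p ->
  exists g (gA : g \in graph_aut G), forall e, c (p e) = c (aut_edge gA e).
Proof.
move=> cF; elim=> {p} [|p x _ [g [gA pg]] xF].
  exists 1%g, (group1 _) => e; congr c; apply: val_inj.
  by case: e => -[u v] uv; rewrite /= /pair_map /= !perm1.
have [y yF xy] := fold_conj gA xF.
have [h _ /color_isoP[hA hc]] := cF y yF.
have hA' : h^-1%g \in graph_aut G by rewrite groupV.
exists (g * h^-1)%g, (groupM gA hA') => e /=.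
by rewrite pg xy aut_edgeM -[RHS]hc /= aut_edgeKV.
Qed.

(** The E_i are the preimages of the edge in E_0 under longer and longer words, so E_n = E(G) says
    that the last word is constant. Conversely, [e0] provides the value of a constant word. *)
Lemma cut_percolatingP (e0 : edge G) : cut_percolating F <->
  exists2 p, fold_monoid p & forall e e', p e = p e'.
Proof.
split=> [[n [E [/eqP/cards1P[a E0] En Estep]]]|[p pM pcst]].
  suff /(_ n (leqnn n))[p pM pE] : forall m, (m <= n)%N ->
      exists2 p, fold_monoid p & E m = p @^-1: E 0%N.
    exists p => // e e'; have pa b : p b = a.
      by have := finset.in_setT b; rewrite -En pE inE E0 => /set1P.
    by rewrite !pa.
  elim=> [_|m IH mn]; first by exists id; [constructor|apply/setP=> e; rewrite inE].
  have [p pM pE] := IH (ltnW mn); have [x xF xE] := Estep m mn.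
  exists (p \o fold_edge x); first exact: FoldMonoidS.
  by rewrite xE pE; apply/setP=> e; rewrite !inE.
suff [n [E [E0 En Estep]]] : exists n (E : nat -> {set edge G}),
    [/\ E 0%N = [set p e0], E n = p @^-1: [set p e0] &
      forall i, (i < n)%N -> exists2 x, val x \in F & E i.+1 = fold_edge x @^-1: E i].
  exists n, E; split=> //; first by rewrite E0 cards1.
  by rewrite En; apply/setP=> e; rewrite !inE; apply/eqP/pcst.
(* The value is generalized to any edge [a], because [p e0] would change with p in the induction. *)
move: {pcst}(p e0) => a; elim: pM => {p} [|p x _ [n [E [E0 En Es]]] xF].
  by exists 0%N, (fun=> [set a]); split=> //; apply/setP=> e; rewrite !inE.
exists n.+1, (fun i => if (i <= n)%N then E i else fold_edge x @^-1: E n); split.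
- by [].
- by rewrite ltnn En; apply/setP=> e; rewrite !inE.
move=> i; rewrite ltnS /= leq_eqVlt => /predU1P[->|i_n].
  by rewrite ltnn eqxx; exists x.
by rewrite i_n orbT; exact: Es.
Qed.

(* p generates a minimal right ideal of the finite monoid. *)
Lemma minimal_right_ideal : exists2 p, fold_monoid p &
  forall m, fold_monoid m -> exists2 m', fold_monoid m' & p \o m \o m' = p.
Proof.
(* [D p] is the right ideal p M. For p with the fewest elements in it, the ideal p m M contained in
   p M must be all of it, so it contains p. *)
pose D p := [set q : {ffun edge G -> edge G} |
  `[< exists2 m, fold_monoid m & (q : _ -> _) = p \o m >]].
have exn : exists n, `[< exists2 p, fold_monoid p & #|D p| = n >].
  by exists #|D id|; apply/asboolP; exists id; [constructor|].
case: (ex_minnP exn) => n /asboolP[p pM Dp] min_n; exists p => // m mM.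
have subD : D (p \o m) \subset D p.
  apply/fintype.subsetP=> q; rewrite inE => /asboolP[m' m'M qE].
  by rewrite inE; apply/asboolP; exists (m \o m'); rewrite ?qE //; exact: fold_monoid_comp.
have /eqP eqD : D (p \o m) == D p.
  rewrite eqEcard subD Dp min_n //; apply/asboolP.
  by exists (p \o m) => //; exact: fold_monoid_comp.
have : finfun p \in D (p \o m).
  rewrite eqD inE; apply/asboolP; exists id; first by constructor.
  by apply/funext=> e; rewrite ffunE.
rewrite inE => /asboolP[m' m'M E]; exists m' => //; rewrite -E.
by apply/funext=> e; rewrite ffunE.
Qed.

End Monoid.

(** * Counting color-preserving homomorphisms *)

Section HomCounting.
Variables (G : bigraph) (C : Type) (target : coloring G C) (S : {set G}).
Implicit Types (x : fold G) (d : coloring G C) (psi rho : {ffun G -> G}) (v : G).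

(** The bipartition is mentioned because the condition on edges does not see isolated vertices. The
    set S of allowed values later serves to prescribe the image. *)
Definition color_homs d : {set {ffun G -> G}} :=
  [set psi : {ffun G -> G} |
     [forall v, (psi v \in S) && ((psi v \in part1 G) == (v \in part1 G))] &&
     [forall e : edge G,
       `[< exists2 e', val e' = pair_map psi (val e) & target e' = d e >]]].

Lemma color_homsP d psi : reflect
  [/\ forall v, psi v \in S, forall v, (psi v \in part1 G) = (v \in part1 G) &
      forall e : edge G, exists2 e', val e' = pair_map psi (val e) & target e' = d e]
  (psi \in color_homs d).
Proof.
rewrite inE; apply: (iffP andP) => [[/forallP hv /forallP he]|[h1 h2 h3]]; last first.
  by split; [apply/forallP=> v; rewrite h1 h2 /=|apply/forallP=> e; apply/asboolP].
by split=> [v|v|e]; [case/andP: (hv v)|case/andP: (hv v) => _ /eqP|exact/asboolP].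
Qed.

(** Off Fix(f) the value v is a placeholder that makes the restriction a total function. *)
Definition fold_restr x psi : {ffun G -> G} :=
  [ffun v => if (val x).1 v == v then psi v else v].

(** With [d \o fold_edge x], these encode the homomorphisms from the side L together with Fix(f)
    that equal [rho] on Fix(f): each extends uniquely to an f-invariant map on G. With
    [fold_edge_star] the side is f(L). *)
Definition half_homs x rho d :=
  [set psi in color_homs d |
     [forall v, psi ((val x).1 v) == psi v] && (fold_restr x psi == rho)].

Lemma half_homsP x rho d psi : reflect
  [/\ psi \in color_homs d, forall v, psi ((val x).1 v) = psi v & fold_restr x psi = rho]
  (psi \in half_homs x rho d).
Proof.
rewrite [X in reflect _ X]inE; apply: (iffP and3P) => [[h /forallP hs /eqP hr]|[h hs hr]].
  by split=> // v; exact/eqP.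
by split=> //; [apply/forallP=> v; rewrite hs|rewrite hr].
Qed.

Lemma fold_restr_fixed x psi psi' v :
  fold_restr x psi = fold_restr x psi' -> (val x).1 v = v -> psi v = psi' v.
Proof. by move=> /ffunP/(_ v) E fv; move: E; rewrite !ffunE fv eqxx. Qed.

Lemma fold_map_part1 x v : (fold_map (val x) v \in part1 G) = (v \in part1 G).
Proof. by rewrite fold_mapE; case: ifP => // _; rewrite (graph_aut_part1 _ (fold_aut x)). Qed.

Lemma fold_map_star_part1 x v : (fold_map_star (val x) v \in part1 G) = (v \in part1 G).
Proof. by rewrite fold_map_starE; case: ifP => // _; rewrite (graph_aut_part1 _ (fold_aut x)). Qed.

Lemma edge_side x (e : edge G) :
  ((val x).1 (val e).1 \notin (val x).2 /\ (val x).1 (val e).2 \notin (val x).2) \/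
  ((val e).1 \notin (val x).2 /\ (val e).2 \notin (val x).2).
Proof.
case: e => -[u v] uv /=; have [h1 h2] := @fold_edge_side _ x u v uv.
have [uL|uL] := boolP (u \in (val x).2).
  by left; split; [exact: fold_side_disjoint|exact: h1].
have [vL|vL] := boolP (v \in (val x).2); last by right.
by left; split; [exact: h2|exact: fold_side_disjoint].
Qed.

Lemma fold_edge_id x (e : edge G) :
  (val x).1 (val e).1 \notin (val x).2 -> (val x).1 (val e).2 \notin (val x).2 ->
  fold_edge x e = e.
Proof.
case: e => -[u v] uv /= fu fv; apply: val_inj.
by rewrite /= /pair_map /= !fold_mapE (negPf fu) (negPf fv).
Qed.

Lemma fold_edge_star_id x (e : edge G) :
  (val e).1 \notin (val x).2 -> (val e).2 \notin (val x).2 -> fold_edge_star x e = e.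
Proof.
case: e => -[u v] uv /= fu fv; apply: val_inj.
by rewrite /= /pair_map /= !fold_map_starE (negPf fu) (negPf fv).
Qed.

(* psi corresponds to the pair of its restrictions to the two sides of the
   fold, which agree on the fixed points. *)
Lemma card_color_homs x d : #|color_homs d| =
  (\sum_rho #|half_homs x rho (d \o fold_edge x)| *
            #|half_homs x rho (d \o fold_edge_star x)|)%N.
Proof.
pose sp psi : {ffun G -> G} * {ffun G -> G} :=
  ([ffun v => psi (fold_map (val x) v)], [ffun v => psi (fold_map_star (val x) v)]).
have sp_inj : injective sp.
  move=> psi psi' [/ffunP E /ffunP E']; apply/ffunP=> v.
  move: (E v) (E' v); rewrite !ffunE fold_mapE fold_map_starE.
  case: ifP => // fvL _.
  by have := fold_side_disjoint fvL; rewrite fold_invol => /negPf->.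
rewrite -(card_imset _ sp_inj).
rewrite -sum1_card (partition_big (fun q => fold_restr x q.1) predT) //=.
apply: eq_bigr => rho _; rewrite -cardsX -sum1_card; apply: eq_bigl => -[p1 p2].
rewrite [RHS]finset.in_setX /=; apply/andP/andP => [|].
  case=> /imsetP[psi /color_homsP[h1 h2 h3] [-> ->]] /eqP Er.
  split; apply/half_homsP; split.
  - apply/color_homsP; split=> [v|v|e]; rewrite ?ffunE ?h1 ?h2 ?fold_map_part1 //.
    by have [e' E1 E2] := h3 (fold_edge x e); exists e' => //; rewrite E1 /pair_map /= !ffunE.
  - by move=> v; rewrite !ffunE fold_map_invol.
  - exact: Er.
  - apply/color_homsP; split=> [v|v|e]; rewrite ?ffunE ?h1 ?h2 ?fold_map_star_part1 //.
    by have [e' E1 E2] := h3 (fold_edge_star x e); exists e' => //; rewrite E1 /pair_map /= !ffunE.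
  - by move=> v; rewrite !ffunE fold_map_star_invol.
  - rewrite -Er; apply/ffunP=> v; rewrite !ffunE; case: eqP => // fv.
    by rewrite fold_map_fixed // fold_map_star_fixed.
case=> /half_homsP[/color_homsP[h1 h2 h3] s1 r1] /half_homsP[/color_homsP[k1 k2 k3] s2 r2].
split; last exact/eqP.
(* Gluing: [p2] on f(L) and [p1] elsewhere. On Fix(f) the two agree, both restricting to [rho], so
   psi equals [p2] on all of the complement of L. *)
pose psi : {ffun G -> G} := [ffun v => if (val x).1 v \in (val x).2 then p2 v else p1 v].
have psi1 v : (val x).1 v \notin (val x).2 -> psi v = p1 v.
  by move=> /negPf fv; rewrite ffunE fv.
have psi2 v : v \notin (val x).2 -> psi v = p2 v.
  move=> vL; rewrite ffunE; case: ifP => // fvL.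
  case: (fold_cover x v) => [fv||]; rewrite ?(negPf vL) ?fvL //.
  by apply: (@fold_restr_fixed x) => //; rewrite r1.
apply/imsetP; exists psi; last first.
  congr pair; apply/ffunP=> v; rewrite ffunE.
    rewrite fold_mapE; case: ifP => [fvL|/negbT/psi1-> //].
    by rewrite psi1 ?s1 //; exact: fold_side_disjoint.
  rewrite fold_map_starE; case: ifP => [vL|/negbT/psi2-> //].
  by rewrite psi2 ?s2 //; exact: fold_side_disjoint.
apply/color_homsP; split=> [v|v|e]; try by rewrite ffunE; case: ifP.
have [[fu fv]|[uL vL]] := edge_side x e.
  have [e' E1 E2] := h3 e; exists e'; last by rewrite E2 /= fold_edge_id.
  by rewrite E1 /pair_map !psi1.
have [e' E1 E2] := k3 e; exists e'; last by rewrite E2 /= fold_edge_star_id.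
by rewrite E1 /pair_map !psi2.
Qed.

(** Folding once more by f_L or by its dual does not change d \o f_L, so the two factors of each
    term coincide. *)
Lemma card_color_homs_fold x d : #|color_homs (d \o fold_edge x)| =
  (\sum_rho #|half_homs x rho (d \o fold_edge x)| ^ 2)%N.
Proof.
have -> : #|color_homs (d \o fold_edge x)| = (\sum_rho
    #|half_homs x rho (d \o fold_edge x)| * #|half_homs x rho (d \o fold_edge x)|)%N.
  rewrite (card_color_homs x); apply: eq_bigr => rho _.
  by congr (#|half_homs _ _ _| * #|half_homs _ _ _|)%N; apply/funext=> e /=;
    congr d; apply: val_inj; rewrite /= /pair_map /= ?fold_mapK ?fold_map_star_id.
by apply: eq_bigr => rho _; rewrite mulnn.
Qed.

Lemma card_color_homs_fold_star x d : #|color_homs (d \o fold_edge_star x)| =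
  (\sum_rho #|half_homs x rho (d \o fold_edge_star x)| ^ 2)%N.
Proof.
have -> : #|color_homs (d \o fold_edge_star x)| = (\sum_rho
    #|half_homs x rho (d \o fold_edge_star x)| * #|half_homs x rho (d \o fold_edge_star x)|)%N.
  rewrite (card_color_homs x); apply: eq_bigr => rho _.
  by congr (#|half_homs _ _ _| * #|half_homs _ _ _|)%N; apply/funext=> e /=;
    congr d; apply: val_inj; rewrite /= /pair_map /= ?fold_star_map_id ?fold_map_star_starK.
by apply: eq_bigr => rho _; rewrite mulnn.
Qed.

(* AM-GM: 2 a b <= a^2 + b^2, summed over rho. *)
Lemma card_color_homs_amgm x d :
  (2 * #|color_homs d| <=
   #|color_homs (d \o fold_edge x)| + #|color_homs (d \o fold_edge_star x)|
   ?= iff [forall rho, #|half_homs x rho (d \o fold_edge x)| ==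
                       #|half_homs x rho (d \o fold_edge_star x)|])%N.
Proof.
rewrite (card_color_homs x d) card_color_homs_fold card_color_homs_fold_star.
rewrite big_distrr -big_split /=; apply: leqif_sum => rho _; exact: nat_Cauchy.
Qed.

End HomCounting.

(** Moebius inversion: the count for images inside S is the sum over subsets S' of S of the counts
    for image exactly S'. Induction on the size of S cancels the proper subsets. *)
Lemma eq_card_image_of_subset (T U : finType) (im : T -> {set U}) (A B : {set T}) :
  (forall S : {set U}, #|[set t in A | im t \subset S]| = #|[set t in B | im t \subset S]|) ->
  forall S : {set U}, #|[set t in A | im t == S]| = #|[set t in B | im t == S]|.
Proof.
move=> AB S; have [n] := ubnP #|S|; elim: n S => // n IH S; rewrite ltnS => Sn.
have cardE (D : {set T}) : #|[set t in D | im t \subset S]| =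
    (#|[set t in D | im t == S]| +
     \sum_(S' : {set U} | S' \proper S) #|[set t in D | im t == S']|)%N.
  rewrite -sum1_card (partition_big im (fun S' : {set U} => S' \subset S)) /=; last first.
    by move=> t; rewrite inE => /andP[].
  have sub1 (S' : {set U}) : S' \subset S ->
      (\sum_(t in [set t in D | im t \subset S] | im t == S') 1)%N =
      #|[set t in D | im t == S']|.
    move=> S'S; rewrite -sum1_card; apply: eq_bigl => t; rewrite !inE.
    by case: eqP => [->|]; rewrite ?S'S ?andbT ?andbF.
  rewrite (bigD1 S) //= sub1 //; congr (_ + _)%N.
  rewrite (eq_bigl (fun S' : {set U} => S' \proper S)); last first.
    by move=> S'; rewrite finset.properEneq andbC.
  by apply: eq_bigr => S' /proper_sub; exact: sub1.
apply/eqP; move/eqP: (AB S); rewrite !cardE.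
rewrite (eq_bigr (fun S' => #|[set t in B | im t == S']|)) ?eqn_add2r // => S' S'S.
by apply: IH; apply: leq_trans Sn; exact: proper_card.
Qed.

(** * Maximal colorings are strongly fold-stable *)

Section MaximalColorings.
Variables (G : bigraph) (F : {set {perm G} * {set G}}) (C : Type).
Hypothesis F_folds : F \subset Fold G.
Hypothesis F_invariant : invariant_folds (graph_aut_group G) F.
Implicit Types (x : fold G) (c d : coloring G C) (v : G).

Lemma reach_maximalP c : reach_maximal F c ->
  forall m, fold_monoid F m -> exists2 m', fold_monoid F m' & c \o m \o m' = c.
Proof.
move=> cmax m mM; have /cmax/(reachP F_folds F_invariant)[m' m'M E] : reach F c (c \o m).
  by apply/(reachP F_folds F_invariant); exists m.
by exists m'; rewrite // -E.
Qed.

(** Let n be the largest hom count among the c \o m. Where it is attained, AM-GM gives 2n <= a + b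
    with a, b <= n, so it is attained after each further fold, and hence at c, which is reachable
    from c \o m. Equality in AM-GM at c holds term by term. *)
Lemma maximal_card_half_homs target S c x rho :
  reach_maximal F c -> val x \in F ->
  #|half_homs target S x rho (c \o fold_edge x)| =
  #|half_homs target S x rho (c \o fold_edge_star x)|.
Proof.
move=> /reach_maximalP cmax xF; pose N d := #|color_homs target S d|.
have exN : exists n, `[< exists2 m, fold_monoid F m & N (c \o m) = n >].
  by exists (N (c \o id)); apply/asboolP; exists id; [constructor|].
have bN n : `[< exists2 m, fold_monoid F m & N (c \o m) = n >] ->
    (n <= #|{ffun G -> G}|)%N by move=> /asboolP[m _ <-]; exact: max_card.
case: (ex_maxnP exN bN) => n /asboolP[m mM cm] maxN.
have leN m' : fold_monoid F m' -> (N (c \o m') <= n)%N.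
  by move=> m'M; apply: maxN; apply/asboolP; exists m'.
have starM m' y : fold_monoid F m' -> val y \in F ->
    fold_monoid F (m' \o fold_edge_star y).
  by move=> m'M yF; have [z zF <-] := fold_edge_starE F_folds F_invariant yF; exact: FoldMonoidS.
have step d y m' : fold_monoid F m' -> d = c \o m' -> N d = n -> val y \in F ->
    N (d \o fold_edge y) = n /\ N (d \o fold_edge_star y) = n.
  move=> m'M dE Nd yF; have [+ _] := card_color_homs_amgm target S y d.
  rewrite -!/(N _) Nd mul2n -addnn dE.
  have := leN _ (FoldMonoidS m'M yF); have := leN _ (starM _ _ m'M yF).
  by rewrite compA compA; lia.
have const m' : fold_monoid F m' -> N (c \o (m \o m')) = n.
  elim=> {m'} [|m' y m'M IH yF]; first by rewrite -cm.
  by have [] := step _ y _ (fold_monoid_comp mM m'M) erefl IH yF.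
have Nc : N c = n.
  by have [m' m'M {1}<-] := cmax m mM; rewrite -compA; exact: const.
have [Nx Nx'] := step c x id (FoldMonoid1 F) erefl Nc xF.
have [_] := card_color_homs_amgm target S x c.
rewrite -!/(N _) Nc Nx Nx' mul2n -addnn eqxx => /esym/forallP/(_ rho)/eqP; exact.
Qed.

(** The map f_L itself is counted for c \o f_L, with image the union D of L and Fix(f). Equal counts
    with prescribed image give a map psi counted for the dual folding with the same image; it
    permutes D, and p is psi on L and the identity elsewhere. *)
Lemma maximal_half_automorphism c x : reach_maximal F c -> val x \in F ->
  exists p (pA : p \in graph_aut G),
    (forall v, v \notin (val x).2 -> p v = v) /\
    forall e : edge G, (val x).1 (val e).1 \notin (val x).2 ->
      (val x).1 (val e).2 \notin (val x).2 ->
      c (aut_edge pA e) = c (aut_edge (fold_aut x) e).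
Proof.
move=> cmax xF; pose f := (val x).1; pose L := (val x).2.
(* Having restriction [rho0] means fixing Fix(f) pointwise. *)
pose rho0 : {ffun G -> G} := [ffun v => v].
pose im (psi : {ffun G -> G}) := [set psi v | v : G].
pose A d := half_homs c [set: G] x rho0 d.
have homS S d : half_homs c S x rho0 d = [set psi in A d | im psi \subset S].
  apply/setP=> psi; rewrite [RHS]inE; apply/half_homsP/andP.
    case=> /color_homsP[h1 h2 h3] hs hr; split; last first.
      by apply/fintype.subsetP=> _ /imsetP[v _ ->].
    by apply/half_homsP; split=> //; apply/color_homsP; split=> // v; rewrite inE.
  case=> /half_homsP[/color_homsP[_ h2 h3] hs hr] /fintype.subsetP imS.
  by split=> //; apply/color_homsP; split=> // v; apply: imS; exact: imset_f.
have cardA (S : {set G}) : #|[set psi in A (c \o fold_edge x) | im psi \subset S]| =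
               #|[set psi in A (c \o fold_edge_star x) | im psi \subset S]|.
  by have := maximal_card_half_homs c S rho0 cmax xF; rewrite !homS.
pose phi : {ffun G -> G} := [ffun v => fold_map (val x) v].
have restr_fix (psi : {ffun G -> G}) : fold_restr x psi = rho0 -> forall v, f v = v -> psi v = v.
  by move=> /ffunP E v fv; have := E v; rewrite !ffunE -/f fv eqxx.
have phiA : phi \in [set psi in A (c \o fold_edge x) | im psi == im phi].
  rewrite inE eqxx andbT; apply/half_homsP; split.
  - apply/color_homsP; split=> [v|v|e]; rewrite ?ffunE ?inE ?fold_map_part1 //.
    by exists (fold_edge x e); rewrite //= /pair_map !ffunE.
  - by move=> v; rewrite !ffunE fold_map_invol.
  - by apply/ffunP=> v; rewrite !ffunE; case: eqP => // /fold_map_fixed.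
have : (0 < #|[set psi in A (c \o fold_edge_star x) | im psi == im phi]|)%N.
  by rewrite -(eq_card_image_of_subset cardA); apply/card_gt0P; exists phi.
case/card_gt0P=> psi; rewrite inE => /andP[/half_homsP[/color_homsP[_ h2 h3] hs hr] /eqP imE].
have psif := restr_fix _ hr.
have phi_id v : f v \notin L -> phi v = v by move=> /negPf fv; rewrite ffunE fold_mapE -/f -/L fv.
pose D := [set v | f v \notin L].
have imD : im phi = D.
  apply/setP=> v; rewrite inE; apply/imsetP/idP=> [[w _ ->]|/phi_id{1}<-]; last by exists v.
  rewrite ffunE fold_mapE -/f -/L; case: ifP => [fwL|/negbT //].
  exact: fold_side_disjoint.
have fD v : (f v \in D) = (v \notin L) by rewrite inE /f fold_invol.
(* By f-invariance psi takes all its values already on D, and its image is D. *)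
have psiD : psi @: D = D.
  rewrite -{2}imD -imE; apply/setP=> w; apply/imsetP/imsetP=> -[v _ ->].
    by exists v.
  have [vD|] := boolP (v \in D); first by exists v.
  rewrite inE negbK => fvL; exists (f v); last by rewrite hs.
  by rewrite fD; have := fold_side_disjoint fvL; rewrite fold_invol.
have psi_inj : {in D &, injective psi} by apply/imset_injP; rewrite psiD.
pose p0 v := if v \in L then psi v else v.
have p0D v : v \in D -> p0 v = psi v.
  rewrite /p0 inE => fvL; case: ifP => // /negbT vL; rewrite psif //.
  by case: (fold_cover x v) => //; rewrite -/f -/L ?(negPf vL) ?(negPf fvL).
have LD v : v \in L -> v \in D by rewrite inE; exact: fold_side_disjoint.
have p0DD v : v \in D -> p0 v \in D by move=> vD; rewrite p0D // -psiD imset_f.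
have p0nD v : v \notin D -> p0 v = v by rewrite /p0; case: ifP => // /LD->.
have p0_inj : injective p0.
  move=> u v; have [uD|uD] := boolP (u \in D); have [vD|vD] := boolP (v \in D).
  - by rewrite !p0D //; exact: psi_inj.
  - by rewrite (p0nD v) // => E; rewrite -E p0DD in vD.
  - by rewrite (p0nD u) // => E; rewrite E p0DD in uD.
  - by rewrite !p0nD.
pose p := perm p0_inj.
have pA : p \in graph_aut G.
  apply: graph_aut_of_edges => [v|e eE].
    by rewrite permE /p0; case: ifP => // _; exact: h2.
  have [[fu fv]|[uL vL]] := edge_side x (exist _ e eE : edge G).
    have [e' E _] := h3 (exist _ e eE).
    by rewrite /pair_map !permE !p0D ?inE //; rewrite /pair_map /= in E; rewrite -E; case: (e').
  by rewrite /pair_map !permE /p0 (negPf uL) (negPf vL) -surjective_pairing.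
exists p, pA; split=> [v vL|e fu fv]; first by rewrite permE /p0 (negPf vL).
have [e' E1 E2] := h3 e; have -> : aut_edge pA e = e'.
  by apply: val_inj; rewrite E1 /= /pair_map !permE !p0D ?inE.
rewrite E2 /=; congr c; apply: val_inj; rewrite /= /pair_map /=.
have starE v : f v \notin L -> fold_map_star (val x) v = f v.
  rewrite fold_map_starE -/f -/L; case: ifP => // /negbT vL fvL.
  by case: (fold_cover x v) => //; rewrite -/f -/L ?(negPf vL) ?(negPf fvL).
by rewrite !starE.
Qed.

(* p \o f \o p^-1 preserves c, and f \o p \o f maps c to c \o f_L. *)
Lemma maximal_strongly_fold_stable c : reach_maximal F c ->
  strongly_fold_stable (Fold G) (graph_aut_group G) F c.
Proof.
move=> cmax.
suff both x : val x \in F ->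
    (exists2 g, g \in graph_aut_group G & color_iso g c (c \o fold_edge x)) /\
    exists h, [/\ color_iso h c c, fixed_points h = fixed_points (val x).1 &
                  (h, (val x).2) \in Fold G].
  split=> [x xF|f L fLF]; first by case: (both x xF).
  by case: (both (fold_of F_folds fLF) fLF).
move=> xF; have [p [pA [pid pc]]] := maximal_half_automorphism cmax xF.
have fA := fold_aut x; have ff := fold_invol x; move: pc.
set f := (val x).1 in fA ff pid *; set L := (val x).2 in pid *.
move=> pc.
have pL v : v \in L -> p v \in L.
  by move=> vL; apply/negPn/negP=> pvL; have /perm_inj E := pid _ pvL; rewrite E vL in pvL.
have pD v : f v \notin L -> f (p v) \notin L.
  move=> fvL; have [vL|/pid->//] := boolP (v \in L).
  exact/fold_side_disjoint/pL.
have pVD v : f v \notin L -> f (p^-1%g v) \notin L.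
  apply: contra => fL; have : p^-1%g v \notin L.
    by have := fold_side_disjoint fL; rewrite -/f -/L ff.
  by move=> /pid; rewrite permKV => {1}->.
have fpA : (f ^ p)%g \in graph_aut G by rewrite groupJ.
have pfA : (p ^ f)%g \in graph_aut G by rewrite groupJ.
have pfE v : (p ^ f)%g v = f (p (f v)).
  rewrite conjgE !permM; congr (f (p _)).
  by apply: (@perm_inj _ f); rewrite permKV ff.
have foldL : (f ^ p, L)%g \in Fold G.
  have -> : L = p @: L.
    apply/esym/eqP; rewrite eqEcard (card_imset _ (@perm_inj _ p)) leqnn andbT.
    by apply/fintype.subsetP=> _ /imsetP[v /pL pvL ->].
  apply: (fintype.subsetP F_folds); apply: F_invariant => //.
  by rewrite -surjective_pairing.
split.
  exists (p ^ f)%g => //; apply/color_isoP; exists pfA => e /=.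
  (* Off f(L), both f p f and f_L fix the edge. Off L, f_L \o f p f sends e to p f e, which has the
     color of f f e = e. *)
  have [[fu fv]|[uL vL]] := edge_side x e.
    rewrite (_ : fold_edge x _ = e) //; apply: val_inj.
    rewrite /= /pair_map /= !pfE !pid // !ff.
    by case: e fu fv => -[u v] uv /= fu fv; rewrite !fold_mapE -/f -/L (negPf fu) (negPf fv).
  have fe w : w \notin L -> f (f w) \notin L by rewrite ff.
  rewrite (_ : fold_edge x _ = aut_edge pA (aut_edge (fold_aut x) e)); last first.
    apply: val_inj; rewrite /= /pair_map /= !pfE !fold_map_invol !fold_mapE.
    by rewrite -/f -/L !(negPf (pD _ (fe _ _))).
  rewrite pc /= ?ff //; congr c; apply: val_inj.
  by case: (e) => -[u v] uv; rewrite /= /pair_map /= -/f !ff.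
exists (f ^ p)%g; split=> //.
  apply/color_isoP; exists fpA => e.
  have pA' : p^-1%g \in graph_aut G by rewrite groupV.
  have fpE v : (f ^ p)%g v = p (f (p^-1%g v)) by rewrite conjgE !permM.
  have -> : aut_edge fpA e = aut_edge pA (aut_edge (fold_aut x) (aut_edge pA' e)).
    by apply: val_inj; rewrite /= /pair_map /= !fpE.
  (* Off f(L), the outer p acts trivially, and f p^-1 e has the color of p p^-1 e = e. Off L, p^-1
     acts trivially, and p f e has the color of f f e = e. *)
  have [[fu fv]|[uL vL]] := edge_side x e.
    have -> : aut_edge pA (aut_edge (fold_aut x) (aut_edge pA' e)) =
              aut_edge (fold_aut x) (aut_edge pA' e).
      by apply: val_inj; rewrite /= /pair_map /= !pid ?pVD.
    by rewrite -pc /= ?pVD // aut_edgeKV.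
  have -> : aut_edge pA' e = e.
    apply: val_inj; case: e uL vL => -[u v] uv /= uL vL; rewrite /pair_map /=.
    by rewrite -{1}(pid _ uL) -{1}(pid _ vL) !permK.
  rewrite pc /= ?ff //; congr c; apply: val_inj.
  by case: (e) => -[u v] uv; rewrite /= /pair_map /= -/f !ff.
apply/setP=> v; rewrite !inE -[v in LHS](permKV p) permJ (inj_eq perm_inj).
have fixp w : f w = w -> p w = w by move=> /fold_fixed_notin/pid.
apply/eqP/eqP=> [/[dup]/fixp + fw|/[dup] fv /fixp pv].
  by rewrite permKV => vE; rewrite vE.
by rewrite -{1 2}pv permK.
Qed.

End MaximalColorings.

(** * Percolation along the periodic full binary tree *)

Section Trees.
Variable G : bigraph.

(** As an iterate of [tree_up], so that [tree_up (full_tree k)] is [full_tree k.+1] by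
    definition. *)
Definition full_tree (k : nat) : {fset seq bool} := iter k tree_up fset0.
Arguments full_tree : simpl never.

Lemma in_full_tree k (s : seq bool) : (s \in full_tree k) = (size s < k)%N.
Proof.
elim: k s => [|k IH] s; first by rewrite in_fset0.
rewrite /full_tree iterS -/(full_tree k) in_fsetU in_fset1.
case: s => [|i s]; first by rewrite eqxx.
rewrite /= ltnS -IH; apply/imfset2P/idP => [[j _ [t tk [_ ->]]]//|sk].
exists i; first by rewrite !inE; case: i.
by exists s.
Qed.

Lemma in_leaves_full_tree k s : (s \in leaves (full_tree k.+1)) = (size s == k).
Proof.
apply/imfsetP/eqP => [[t /andP[+ /allP leaf] ->]|sk].
  rewrite /= in_full_tree ltnS => sk.
  apply/eqP; rewrite eqn_leq sk leqNgt; apply/negP=> ltsk.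
  have := leaf (false :: t); rewrite in_full_tree /= ltnS => /(_ ltsk)/implyP.
  rewrite (suffix_suffix [:: false]) => /(_ isT)/eqP/(congr1 size) /=.
  by move=> /esym/n_Sn.
exists s => //; apply/andP; split=> /=; first by rewrite in_full_tree sk.
apply/allP=> t; rewrite in_full_tree ltnS => tk.
apply/implyP=> /suffixP[u tE]; move: tk; rewrite tE size_cat sk.
by case: u {tE} => //= a u; rewrite addSn ltnNge leq_addl.
Qed.

Lemma tree_measure_full (R : realType) (C : Type) k (phi : {fmap seq bool -> fold G})
    (c : coloring G C) A : domf phi = full_tree k ->
  tree_measure R phi c A =
  (#|[set t : k.-tuple bool | `[< A (tree_coloring phi c t) >]]|%:R / 2 ^+ k)%R.
Proof.
move=> domE; rewrite /tree_measure domE -/(full_tree k.+1).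
rewrite (perm_big [seq val t | t : k.-tuple bool]) /=; last first.
  apply: uniq_perm; first exact: fset_uniq.
    by rewrite map_inj_uniq ?enum_uniq //; exact: val_inj.
  move=> s; rewrite in_leaves_full_tree; apply/idP/mapP => [sk|[t _ ->]].
    by exists (Tuple sk); rewrite ?mem_enum.
  by rewrite size_tuple.
rewrite big_map big_enum_cond /=.
under eq_bigr do rewrite size_tuple.
rewrite sumr_const mulr_natl; congr (_ *+ _)%R.
by apply: eq_card => t; rewrite !inE.
Qed.

Variable F : {set {perm G} * {set G}}.
Hypothesis F_folds : F \subset Fold G.
Hypothesis F_invariant : invariant_folds (graph_aut_group G) F.

Lemma tree_coloring_monoid (C : Type) phi (c : coloring G C) eta :
  folding_tree F phi -> exists2 p, fold_monoid F p & tree_coloring phi c eta = c \o p.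
Proof.
case=> _ phiF; elim: eta => [|i eta [p pM E]]; first by exists id; [constructor|].
rewrite /= E; case Ex : (phi.[? eta]%fmap) => [x|]; last by exists p.
have xF := phiF _ _ Ex; case: i; last by exists (p \o fold_edge x) => //; constructor.
have [y yF <-] := fold_edge_starE F_folds F_invariant xF.
by exists (p \o fold_edge y) => //; constructor.
Qed.

(** If no word led into A, all measures would be 0 and could not tend to 1. *)
Lemma percolates_monoid (R : realType) (C : Type) (c : coloring G C) A :
  percolates R F c A -> exists2 p, fold_monoid F p & A (c \o p).
Proof.
case=> phi [phiF _ cvg1]; apply: contrapT => noA.
have mu0 : (fun n => tree_measure R (phi n) c A) = fun=> 0%R.
  apply/funext=> n; rewrite /tree_measure big1 // => eta /asboolP Aeta.
  exfalso; apply: noA; have [p pM E] := tree_coloring_monoid c eta (phiF n).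
  by exists p; rewrite // -E.
rewrite mu0 in cvg1.
have /eqP : (0%R : R) = 1%R by exact: norm_cvg_unique (cvg_cst (0%R : R)) cvg1.
by rewrite eq_sym oner_eq0.
Qed.

Lemma fold_monoid_seq p : fold_monoid F p ->
  exists2 s : seq (fold G), forall x, x \in s -> val x \in F &
    p = foldl (fun q x => q \o fold_edge x) id s.
Proof.
elim=> {p} [|p x _ [s sF E] xF]; first by exists [::].
exists (rcons s x); last by rewrite foldl_rcons -E.
by move=> y; rewrite mem_rcons inE => /predU1P[->|/sF].
Qed.

Section PeriodicTree.
Variables (x0 : fold G) (s : seq (fold G)).
Hypothesis s_gt0 : (0 < size s)%N.
Hypothesis sF : forall x, x \in s -> val x \in F.
Let n := size s.

Definition periodic_fold (eta : seq bool) : fold G := nth x0 s (size eta %% n).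

Definition periodic_tree k : {fmap seq bool -> fold G} :=
  [fmap eta : full_tree k => periodic_fold (val eta)]%fmap.

Lemma periodic_tree_fnd k eta : (periodic_tree k).[? eta]%fmap =
  if (size eta < k)%N then Some (periodic_fold eta) else None.
Proof.
rewrite -in_full_tree; case: ifP => [etak|/negbT etak].
  by rewrite (in_fnd etak) ffunE.
by rewrite not_fnd.
Qed.

Lemma periodic_folding_tree k : folding_tree F (periodic_tree k).
Proof.
split=> [u v uv|eta x]; last first.
  rewrite periodic_tree_fnd; case: ifP => // _ [<-].
  by apply: sF; rewrite mem_nth // ltn_mod.
by rewrite !in_full_tree; apply: leq_ltn_trans; exact: size_suffix.
Qed.

Fixpoint periodic_word (eta : seq bool) : edge G -> edge G :=
  if eta is i :: eta' then periodic_word eta' \o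
    (if i then fold_edge_star (periodic_fold eta') else fold_edge (periodic_fold eta'))
  else id.

Lemma periodic_tree_coloring (C : Type) (c : coloring G C) k eta :
  (size eta <= k)%N -> tree_coloring (periodic_tree k) c eta = c \o periodic_word eta.
Proof.
by elim: eta => //= i eta IH etak; rewrite periodic_tree_fnd etak IH 1?ltnW //; case: i.
Qed.

Lemma periodic_word_cat u eta : exists q, periodic_word (u ++ eta) = periodic_word eta \o q.
Proof.
elim: u => [|i u [q /= ->]]; first by exists id.
by eexists; rewrite -compA.
Qed.

(** From a depth divisible by n, the branch with n symbols 1 (that is, [false]) runs once through
    the word s. *)
Lemma periodic_word_block eta : n %| size eta ->
  periodic_word (nseq n false ++ eta) =
  periodic_word eta \o foldl (fun q x => q \o fold_edge x) id s.
Proof.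
move=> n_eta; suff blk m : (m <= n)%N -> periodic_word (nseq m false ++ eta) =
    periodic_word eta \o foldl (fun q x => q \o fold_edge x) id (take m s).
  by rewrite blk // take_size.
elim: m => [|m IH] mn; first by rewrite take0.
rewrite /= IH 1?ltnW // (take_nth x0) // foldl_rcons compA; congr (_ \o fold_edge _).
rewrite /periodic_fold size_cat size_nseq; congr nth.
by move/eqP: n_eta => n_eta; rewrite -modnDmr n_eta addn0 modn_small.
Qed.

Definition nonconstant_words k :=
  [set t : (k * n).-tuple bool |
     ~~ `[< forall e e', periodic_word t e = periodic_word t e' >]].

(** The head of the list is the last block of n symbols. In a nonconstant word this block is not all
    [false], which would compose with the constant word, and the earlier part is nonconstant too;
    this leaves 2^n - 1 choices per block. *)
Lemma card_nonconstant_words k :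
  (forall e e', foldl (fun q x => q \o fold_edge x) id s e =
                foldl (fun q x => q \o fold_edge x) id s e') ->
  (#|nonconstant_words k| <= (2 ^ n - 1) ^ k)%N.
Proof.
move=> s_const; elim: k => [|k IH]; first by rewrite (leq_trans (max_card _)) // card_tuple.
rewrite expnS; apply: leq_trans (leq_mul (leqnn _) IH).
pose D := finset.setX (~: [set nseq_tuple n false]) (nonconstant_words k).
have -> : ((2 ^ n - 1) * #|nonconstant_words k| = #|D|)%N.
  by rewrite cardsX cardsC1 card_tuple card_bool subn1.
pose cat2 (q : n.-tuple bool * (k * n).-tuple bool) : (k.+1 * n).-tuple bool :=
  [tuple of q.1 ++ q.2].
apply: leq_trans (leq_imset_card cat2 D).
apply/subset_leq_card/fintype.subsetP=> t; rewrite inE => /asboolP t_nc.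
have st : (n <= size t)%N by rewrite size_tuple mulSn leq_addr.
have s1 : size (take n t) == n by rewrite size_takel.
have s2 : size (drop n t) == (k * n)%N by rewrite size_drop size_tuple mulSn addKn.
have tE : val t = tval (Tuple s1) ++ tval (Tuple s2) by rewrite /= cat_take_drop.
apply/imsetP; exists (Tuple s1, Tuple s2); last exact: val_inj.
rewrite finset.in_setX /= !inE; apply/andP; split.
  apply/eqP=> t1; apply: t_nc => e e'; rewrite tE t1.
  rewrite periodic_word_block /=; last by rewrite (eqP s2) dvdn_mull.
  by congr periodic_word; exact: s_const.
apply/asboolP=> t2; apply: t_nc => e e'; rewrite tE.
by have [q ->] := periodic_word_cat (Tuple s1) (Tuple s2); exact: t2.
Qed.

Lemma periodic_tree_percolates (R : realType) (C : Type) (c : coloring G C) :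
  (forall e e', foldl (fun q x => q \o fold_edge x) id s e =
                foldl (fun q x => q \o fold_edge x) id s e') ->
  percolates R F c [set d | monochromatic d]%classic.
Proof.
move=> s_const; exists (fun k => periodic_tree (k * n)); split.
- by move=> k; exact: periodic_folding_tree.
- have sub k : (full_tree (k * n) `<=` full_tree (k.+1 * n))%fset.
    apply/fsubsetP=> eta; rewrite !in_full_tree => /leq_trans; apply.
    by rewrite mulSn leq_addl.
  move=> k; split; first exact: sub.
  apply/fmapP=> eta; rewrite fnd_restrict !periodic_tree_fnd /= in_full_tree.
  case: ifP => // etak; rewrite mulSn; have -> // : (size eta < n + k * n)%N.
  by rewrite (leq_trans etak) // leq_addl.
(* The probability that a random block of n symbols is not all [false]; at depth k n the measure is
   at least 1 - q^k. *)
pose q : R := ((2 ^ n - 1)%N%:R / 2 ^+ n)%R.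
have two_gt0 k : (0 < 2 ^+ k :> R)%R by rewrite Num.Theory.exprn_gt0.
apply: (@squeeze_cvgr _ _ _ _ (fun k => 1 - q ^+ k)%R (fun=> 1%R)).
- near=> k; rewrite (@tree_measure_full _ _ (k * n)) //.
  set P := [set t | _]; have cardT : (#|P| + #|~: P| = 2 ^ (k * n))%N.
    by rewrite cardsC card_tuple card_bool.
  have leP : (#|~: P| <= (2 ^ n - 1) ^ k)%N.
    apply: leq_trans (card_nonconstant_words k s_const).
    apply/subset_leq_card/fintype.subsetP=> t; rewrite !inE; apply: contra => /asboolP t_c.
    apply/asboolP; rewrite periodic_tree_coloring ?size_tuple //.
    by move=> _ _ [e _ <-] [e' _ <-] /=; congr c; exact: t_c.
  rewrite Num.Theory.ler_pdivrMr ?two_gt0 // Num.Theory.ler_pdivlMr ?two_gt0 // mul1r.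
  apply/andP; split; last by rewrite -natrX ler_nat -cardT leq_addr.
  rewrite /q expr_div_n -exprM mulrBl mul1r (mulnC n k) mulfVK ?gt_eqF ?two_gt0 //.
  rewrite -!natrX lerBlDr -natrD ler_nat -cardT leq_add2l //.
- have q_lt1 : (`|q| < 1)%R.
    rewrite ger0_norm ?divr_ge0 ?ler0n ?exprn_ge0 //.
    by rewrite ltr_pdivrMr // mul1r -natrX ltr_nat subn1 ltn_predL expn_gt0.
  have lim : ((fun k => 1 - q ^+ k)%R @ \oo --> (1 - 0 : R)%R)%classic.
    by apply: cvgB; [exact: cvg_cst|exact: cvg_expr].
  by rewrite subr0 in lim.
- exact: cvg_cst.
Unshelve. all: by end_near.
Qed.

End PeriodicTree.

Lemma constant_percolates (R : realType) (C : Type) (c : coloring G C) p :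
  fold_monoid F p -> (forall e e', p e = p e') ->
  percolates R F c [set d | monochromatic d]%classic.
Proof.
move=> pM; have [s sF ->] := fold_monoid_seq pM.
case: s sF => [_ /= id_const|x s sF]; last exact: (@periodic_tree_percolates x).
(* For the empty word the identity is already constant, so c is monochromatic and the empty tree
   suffices. *)
exists (fun=> fmap0); split.
- by move=> _; split=> // eta x; rewrite fnd_fmap0.
- by move=> _; split=> //; apply/fmapP=> eta; rewrite fnd_restrict in_fset0 fnd_fmap0.
rewrite (_ : (fun=> _) = fun=> 1%R); first exact: cvg_cst.
apply/funext=> _; rewrite (@tree_measure_full _ _ 0) // expr0 divr1.
rewrite (_ : [set t | _] = [set: 0.-tuple bool]) ?cardsT ?card_tuple //.
apply/setP=> t; rewrite !inE; apply/asboolP; rewrite tuple0 /=.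
by move=> _ _ [e _ <-] [e' _ <-]; congr c; exact: id_const.
Qed.

End Trees.

(** * The equivalences *)

Section Equivalences.
Variables (G : bigraph) (F : {set {perm G} * {set G}}).
Hypothesis F_folds : F \subset Fold G.
Hypothesis F_invariant : invariant_folds (graph_aut_group G) F.

Lemma fold_group_sub : fold_group F \subset graph_aut G.
Proof.
rewrite gen_subG; apply/fintype.subsetP=> _ /imsetP[z zF ->].
exact: (fold_aut (fold_of F_folds zF)).
Qed.

Lemma fold_monoid_orbit p : fold_monoid F p ->
  forall e, exists2 k, k \in fold_group F & pair_map k (val e) = val (p e).
Proof.
elim=> {p} [|p x _ IH xF] e.
  by exists 1%g => //; case: e => -[u v] uv; rewrite /pair_map /= !perm1.
have [k kF kE] := IH (fold_edge x e).
have fF : (val x).1 \in fold_group F by apply: mem_gen; apply: imset_f.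
case: (fold_map_edge_aut x e) => E.
  by exists k; rewrite //= -kE /= E.
exists ((val x).1 * k)%g; first exact: groupM.
by rewrite /= -kE /= E /pair_map /= !permM.
Qed.

Lemma constant_edge_transitive p :
  fold_monoid F p -> (forall e e', p e = p e') -> edge_transitive (fold_group F).
Proof.
move=> pM p_const e1 e2.
have [k1 k1F E1] := fold_monoid_orbit pM e1; have [k2 k2F E2] := fold_monoid_orbit pM e2.
exists (k1 * k2^-1)%g; first by rewrite groupM ?groupV.
move: E1; rewrite (p_const e1 e2) -E2 /pair_map => -[Eu Ev].
by rewrite !permM Eu Ev !permK -surjective_pairing.
Qed.

(** The permutation is transported along the injection r and extended by the identity to the colors
    outside its image. *)
Lemma rainbow_perm (C : Type) (r : coloring G C) (tau : {perm edge G}) :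
  rainbow r -> exists2 sigma : C -> C, bijective sigma & sigma \o r = r \o tau.
Proof.
move=> r_inj.
pose ext (t : {perm edge G}) z :=
  if pselect (exists e, r e = z) is left P then r (t (projT1 (cid P))) else z.
have ext_r t e : ext t (r e) = r (t e).
  rewrite /ext; case: pselect => [P|[]]; last by exists e.
  by congr (r (t _)); apply: r_inj; exact: (projT2 (cid P)).
have extK (t t' : {perm edge G}) : cancel t t' -> cancel (ext t) (ext t').
  move=> tK z; have [[e <-]|nz] := pselect (exists e, r e = z); first by rewrite !ext_r tK.
  by rewrite /ext; case: (pselect (exists e, r e = z)) => // _; case: pselect.
exists (ext tau); last by apply/funext=> e; exact: ext_r.
exists (ext tau^-1%g); apply: extK; [exact: permK|exact: permKV].
Qed.

(* Write c = r \o p and let h in Aut(G) map the edge p a to an edge in the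
   class of j.  Then p \o h \o p = (p \o (h p h^-1)) \o h is isomorphic to p by
   maximality, so p \o h permutes the image of p: this permutation of the
   colors is realized by an automorphism. *)
Lemma maximal_rainbow_symmetric (C : Type) (r : coloring G C)
    (p : edge G -> edge G) :
  rainbow r -> edge_transitive (fold_group F) ->
  fold_monoid F p -> reach_maximal F (r \o p) ->
  symmetrically_fold_stable (Fold G) (graph_aut_group G) F (r \o p).
Proof.
move=> r_inj F_trans pM pmax; have stab := maximal_strongly_fold_stable F_folds F_invariant pmax.
split=> // _ _ [a _ <-] [b _ <-]; have [h hF hab] := F_trans (p a) b.
have hA : h \in graph_aut G := fintype.subsetP fold_group_sub h hF.
have [q qM pq] := fold_monoid_conj F_folds F_invariant hA pM.
have [g [gA qg]] := fold_stable_reach F_folds F_invariant stab.1 qM.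
have php e : p (aut_edge hA (p e)) = p (aut_edge gA (aut_edge hA e)).
  by apply: r_inj; rewrite pq; exact: qg.
have hgA : (h * g)%g \in graph_aut G by rewrite groupM.
have hgA' : ((h * g)^-1)%g \in graph_aut G by rewrite groupV.
pose A := [set p e | e : edge G].
(* By [php], p h p is p after an automorphism, so it has the same image as p. A surjection of the
   finite set A onto itself is injective. *)
have imA : (p \o aut_edge hA) @: A = A.
  apply/setP=> e; apply/imsetP/imsetP=> [[_ /imsetP[e' _ ->] ->]|[e' _ ->]].
    by rewrite /= php; eexists.
  exists (p (aut_edge hgA' e')); first exact: imset_f.
  rewrite /= php -[in RHS](aut_edgeM hA gA) (_ : aut_edge _ _ = e') //.
  by apply: val_inj; rewrite /= /pair_map /= !permKV -surjective_pairing.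
have inj_A : {in A &, injective (p \o aut_edge hA)} by apply/imset_injP; rewrite imA.
pose t0 e := if e \in A then p (aut_edge hA e) else e.
have t0A e : e \in A -> t0 e \in A.
  by move=> eA; rewrite /t0 eA -imA; exact: (imset_f (p \o aut_edge hA)).
have t0nA e : e \notin A -> t0 e = e by rewrite /t0 => /negPf->.
have t0_inj : injective t0.
  move=> e e'; have [eA|eA] := boolP (e \in A); have [e'A|e'A] := boolP (e' \in A).
  - by rewrite /t0 eA e'A; exact: inj_A.
  - by rewrite (t0nA e') // => E; rewrite -E t0A in e'A.
  - by rewrite (t0nA e) // => E; rewrite E t0A in eA.
  - by rewrite !t0nA.
have [sigma sigma_bij sr] := rainbow_perm (perm t0_inj) r_inj.
have srp e : sigma (r (p e)) = r (p (aut_edge hA (p e))).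
  by rewrite -[LHS]/((sigma \o r) (p e)) sr /= permE /t0 imset_f.
exists (h * g)^-1%g, sigma; split=> //.
  rewrite /= srp; congr (r (p _)); apply: val_inj; exact: hab.
apply/color_isoP; exists hgA' => e.
rewrite /= srp php -[X in p X](aut_edgeM hA gA); congr (r (p _)).
by apply: val_inj; rewrite /= /pair_map /= !permKV -surjective_pairing.
Qed.

(** For p generating a minimal right ideal, each p m can be continued back to p, so one p serves all
    colorings. *)
Lemma exists_maximal : exists2 p, fold_monoid F p &
  forall (C : Type) (c : coloring G C), reach_maximal F (c \o p).
Proof.
have [p pM p_min] := minimal_right_ideal F; exists p => // C c c'.
move=> /(reachP F_folds F_invariant)[m mM ->].
have [m' m'M E] := p_min m mM.
by apply/(reachP F_folds F_invariant); exists m'; rewrite // -[in LHS]E.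
Qed.

End Equivalences.

Lemma rainbow_monochromatic (G : bigraph) (C : Type) (r : coloring G C)
    (p : edge G -> edge G) :
  rainbow r -> monochromatic (r \o p) -> forall e e', p e = p e'.
Proof. by move=> r_inj mono e e'; apply: r_inj; apply: mono; [exists e|exists e']. Qed.

Lemma constant_monochromatic (G : bigraph) (C : Type) (c : coloring G C)
    (p : edge G -> edge G) :
  (forall e e', p e = p e') -> monochromatic (c \o p).
Proof. by move=> p_const _ _ [e _ <-] [e' _ <-] /=; rewrite (p_const e e'). Qed.

Theorem theorem8p1 (R : realType) (G : bigraph) (C : Type)
    (F : {set {perm G} * {set G}}) (r : coloring G C)
    (G_connected : connected_bigraph G)
    (G_edges : edges G != finset.set0)
    (F_folds : F \subset Fold G)
    (F_invariant : invariant_folds (graph_aut_group G) F)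
    (r_rainbow : rainbow r) :
  let M : set (coloring G C) := [set c | monochromatic c]%classic in
  [<-> cut_percolating F;
       forall c : coloring G C, reach_set F c M;
       reach_set F r M;
       forall c : coloring G C, percolates R F c M;
       percolates R F r M;
       forall c : coloring G C,
         fold_stable (graph_aut_group G) F c -> monochromatic c;
       forall c : coloring G C,
         strongly_fold_stable (Fold G) (graph_aut_group G) F c -> monochromatic c;
       forall c : coloring G C, reach_maximal F c -> monochromatic c;
       (forall c : coloring G C,
          symmetrically_fold_stable (Fold G) (graph_aut_group G) F c ->
          monochromatic c) /\
       edge_transitive (fold_group F)].
Proof.
move=> M; have /finset.set0Pn[e0 e0E] := G_edges.
have cutP := cut_percolatingP F (exist _ e0 e0E : edge G).
have reach_of c p : fold_monoid F p -> reach F c (c \o p).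
  by move=> pM; apply/(reachP F_folds F_invariant); exists p.
have cut_of_reach : reach_set F r M -> exists2 p, fold_monoid F p & forall e e', p e = p e'.
  case=> c' c'M /(reachP F_folds F_invariant)[p pM E]; exists p => //.
  by apply: (rainbow_monochromatic r_rainbow); rewrite -E.
have stable_mono p : fold_monoid F p -> (forall e e', p e = p e') ->
    forall c : coloring G C, fold_stable (graph_aut_group G) F c -> monochromatic c.
  move=> pM p_const c cF; have [g [gA E]] := fold_stable_reach F_folds F_invariant cF pM.
  have gA' : g^-1%g \in graph_aut G by rewrite groupV.
  move=> _ _ [e _ <-] [e' _ <-]; rewrite -[e](aut_edgeKV gA gA') -[e'](aut_edgeKV gA gA').
  by rewrite -!E; congr c; exact: p_const.
tfae.
- move=> /cutP[p pM p_const] c; exists (c \o p); last exact: reach_of.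
  exact: constant_monochromatic.
- exact.
- by move=> /cut_of_reach[p pM p_const] c; exact: constant_percolates pM p_const.
- exact.
- case/(percolates_monoid F_folds F_invariant)=> p pM rp_mono.
  exact/(stable_mono p pM)/(rainbow_monochromatic r_rainbow).
- by move=> stable c [/stable].
- by move=> strong c /(maximal_strongly_fold_stable F_folds F_invariant)/strong.
- have [p pM p_max] := exists_maximal F_folds F_invariant.
  move=> /(_ _ (p_max _ r))/(rainbow_monochromatic r_rainbow) p_const; split.
    by move=> c [[/(stable_mono p pM p_const)]].
  exact: (constant_edge_transitive pM).
(* The maximal coloring r \o p is symmetrically fold-stable, hence monochromatic, and r is
   injective, so p is constant. *)
case=> symm F_trans; have [p pM p_max] := exists_maximal F_folds F_invariant.
apply/cutP; exists p => //; apply: (rainbow_monochromatic r_rainbow); apply: symm.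
exact: maximal_rainbow_symmetric.
Qed.
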